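(* For every integer $n \geq 1$ and every real $x \neq 0$, $$\left(\frac{d}{dx}\right)^n \frac{1}{e^x - 1} = (-1)^n \frac{e^x}{e^x - 1} \sum_{k=1}^{n} S(n,k)\, k! \left(\frac{1}{e^x - 1}\right)^k .$$
   Context: $S(n,k)$ denotes the Stirling numbers of the second kind (the number of partitions of an $n$-element set into $k$ nonempty blocks). $\left(\frac{d}{dx}\right)^n$ denotes the $n$-th derivative with respect to $x$. *)

(* Defs.v *)
From mathcomp Require Import all_boot.

Set Implicit Arguments.
Unset Strict Implicit.
Unset Printing Implicit Defensive.

(* [partition] requires the blocks to be nonempty, so S(0, 0) = 1 and
   S(n, k) = 0 whenever k > n. *)
Definition stirling2 (n k : nat) : nat :=
  #|[set P : {set {set 'I_n}} | partition P [set: 'I_n] & #|P| == k]|.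

(* Main.v *)
Require Import Defs.
From mathcomp Require Import all_boot all_order all_algebra.
From mathcomp Require Import all_classical all_reals all_analysis.
Import Order.TTheory GRing.Theory Num.Theory.
Import numFieldNormedType.Exports.
From mathcomp Require Import ring.
Local Open Scope ring_scope.
Local Open Scope classical_set_scope.

(** Put u(t) = 1 / (e^t - 1). Away from 0 it satisfies the Riccati equation
    u' = - u (1 + u), and e^t / (e^t - 1) = 1 + u, so the functions u and 1 + u
    have the same derivatives of positive order, all of them polynomials in u.
    If p(u) is one of these derivatives, the next one is - u (1 + u) p'(u).

    Let W_n(X) be the sum over k of S(n, k) k! X^k. The claim is that the n-th
    derivative of 1 + u is (-1)^n (1 + X) W_n evaluated at u. Since W_0 = 1, the
    case n = 0 holds, and the induction step amounts to
      W_(n+1) = X ((1 + X) W_n)'        ([stirling2_polyS]).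
    Comparing coefficients, this is the recurrence
      S(n+1, k+1) = S(n, k) + (k+1) S(n, k+1),
    which is proved on set partitions in [card_partitions_setU1]: removing a
    point from a partition leaves a partition of the other points, and the
    point can be put back as a block of its own or into an existing block. *)

(** * The recurrence for Stirling numbers of the second kind *)

Section SetPartitions.
(* Gives the names of finite sets precedence over those of classical sets. *)
Import mathcomp.boot.finset.
Local Open Scope nat_scope.
Local Open Scope set_scope.

Fixpoint stirling2_rec (n k : nat) : nat :=
  match n, k with
  | 0, 0 => 1
  | 0, _.+1 => 0
  | _.+1, 0 => 0
  | n'.+1, k'.+1 => stirling2_rec n' k' + k'.+1 * stirling2_rec n' k'.+1
  end.

Lemma stirling2_rec_gt n k : n < k -> stirling2_rec n k = 0.
Proof.
elim: n k => [|n IHn] [|k] //=; rewrite ltnS => ltnk.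
by rewrite !IHn // ?muln0 // ltnW.
Qed.

Variable T : finType.
Implicit Types (D A B : {set T}) (P Q : {set {set T}}) (a : T).

Definition partitions D k : {set {set {set T}}} :=
  [set P | partition P D & #|P| == k].

(** The second component of [u] is the block that receives the point [a], with
    the empty set standing for a new block: both ways of extending the partition
    [u.1] are then given by one formula, because [u.1] has no empty block. *)
Definition insert_point a (u : {set {set T}} * {set T}) : {set {set T}} :=
  (a |: u.2) |: (u.1 :\ u.2).

(** Inverse of [insert_point]. If [a] was alone, [B] is empty and has to be
    discarded from the blocks. *)
Definition delete_point a P : {set {set T}} * {set T} :=
  let B := pblock P a :\ a in ((B |: (P :\ pblock P a)) :\ set0, B).

(** Extends [partitionD1] to the conventional empty block. *)
Lemma partitionD10 Q D B :
  partition Q D -> B \in set0 |: Q -> partition (Q :\ B) (D :\: B).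
Proof.
move=> partQ /setU1P[->|/(partitionD1 partQ)//].
rewrite setD0; suff -> : Q :\ set0 = Q by [].
by apply/setDidPl; rewrite disjoint_sym disjoints1 (partition0 partQ).
Qed.

Lemma insert_pointP a D Q B : a \notin D ->
    partition Q D -> B \in set0 |: Q ->
  [/\ partition (insert_point a (Q, B)) (a |: D),
      #|insert_point a (Q, B)| = #|Q| + (B == set0)
    & delete_point a (insert_point a (Q, B)) = (Q, B)].
Proof.
move=> aD partQ QB; have partQB := partitionD10 _ _ _ partQ QB.
have BD : B \subset D.
  by case/setU1P: QB => [->|/(partitionS partQ)//]; rewrite sub0set.
have aB : a \notin B by apply: contra aD; apply: (fintype.subsetP BD).
have Q0 := partition0 partQ.
have partP : partition (insert_point a (Q, B)) (a |: D).
  have -> : a |: D = (a |: B) :|: (D :\: B).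
    by rewrite -setUA -[in LHS](setID D B) (setIidPr BD).
  apply: partitionU1 => //.
    by apply/set0Pn; exists a; rewrite setU11.
  rewrite -setI_eq0; apply/eqP/setP=> y; rewrite !inE.
  by case: eqP => [->|_]; rewrite ?(negbTE aD) ?andbF //= andbA andbN.
have aBQ : a |: B \notin Q :\ B.
  apply/negP => /setD1P[_ /(partitionS partQ)/fintype.subsetP/(_ a)].
  by rewrite setU11 (negbTE aD) => /(_ isT).
split=> //.
  rewrite /insert_point /= cardsU1 aBQ addnC.
  case/setU1P: QB => [->|BQ].
    rewrite eqxx; congr (_ + _); congr #|pred_of_set _|.
    by apply/setDidPl; rewrite disjoint_sym disjoints1 Q0.
  by rewrite (negbTE (partition_neq0 partQ BQ)) addn0 (cardsD1 B Q) BQ addnC.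
rewrite /delete_point.
have -> : pblock (insert_point a (Q, B)) a = a |: B.
  apply: def_pblock; first exact: partition_trivIset partP.
    by rewrite setU11.
  by rewrite setU11.
rewrite setU1K // setU1K //; congr (_, _).
apply/setP=> C; rewrite !inE; case: (eqVneq C set0) => [->|C0] /=.
  by rewrite Q0.
case: (eqVneq C B) => // CB /=; case/setU1P: QB => [B0|//]; last by rewrite -CB.
by rewrite CB B0 eqxx in C0.
Qed.

Lemma delete_pointP a D P : a \notin D -> partition P (a |: D) ->
  let u := delete_point a P in
  [/\ partition u.1 D, u.2 \in set0 |: u.1 & insert_point a u = P].
Proof.
move=> aD partP /=; rewrite /insert_point /=.
have tiP := partition_trivIset partP.
have aP : a \in cover P by rewrite (cover_partition partP) setU11.
set A := pblock P a; set B := A :\ a.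
have PA : A \in P by apply: pblock_mem.
have aA : a \in A by rewrite /A mem_pblock.
have partPA := partitionD1 partP PA.
have PA0 := partition0 partPA.
have AD := partitionS partP PA.
have BPA : B \notin P :\ A.
  apply/negP => BPA; have /set0Pn[b bB] := partition_neq0 partPA BPA.
  have /fintype.subsetP/(_ b bB) := partitionS partPA BPA.
  by move: bB; rewrite !inE => /andP[_ ->].
have aBA : a |: B = A by rewrite setD1K.
split.
- have DE : B :|: ((a |: D) :\: A) = D.
    apply/setP=> y; rewrite !inE; case: (eqVneq y a) => [->|ya] /=.
      by rewrite aA (negbTE aD).
    case yA: (y \in A) => //=.
    by have /fintype.subsetP/(_ y yA) := AD; rewrite !inE (negbTE ya).
  have [B0|Bn0] := eqVneq B set0.
    rewrite B0 setU1K ?PA0 //.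
    by rewrite -[X in partition _ X]DE B0 set0U.
  have -> : (B |: P :\ A) :\ set0 = B |: P :\ A.
    apply/setDidPl; rewrite disjoint_sym disjoints1 !inE eq_sym (negbTE Bn0) /=.
    by move: PA0; rewrite !inE => ->.
  rewrite -[X in partition _ X]DE; apply: partitionU1 => //.
  rewrite -setI_eq0; apply/eqP/setP=> y; rewrite !inE.
  by case: (y \in A); rewrite ?andbF.
- by rewrite !inE eqxx; case: (B == set0).
rewrite aBA -[RHS](setD1K PA); congr (_ |: _).
apply/setP=> C; rewrite in_setD1 in_setD1 in_setU1.
case: (eqVneq C B) => [->|_] /=; first by rewrite (negbTE BPA).
by case: (eqVneq C set0) => [->|//]; rewrite PA0.
Qed.

(** [insert_point a] is a bijection onto the partitions of [a |: D]. Those with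
    k+1 blocks come from the disjoint sets [X0], where [a] forms a new block next
    to k others, and [X1], where [a] joins one of k+1 blocks. *)
Lemma card_partitions_setU1 a D k : a \notin D ->
  #|partitions (a |: D) k.+1| =
  #|partitions D k| + k.+1 * #|partitions D k.+1|.
Proof.
move=> aD.
pose X0 := setX (partitions D k) [set set0 : {set T}].
pose X1 := [set u : {set {set T}} * {set T} |
             (u.1 \in partitions D k.+1) && (u.2 \in u.1)].
have X01 u : (u \in X0 :|: X1) =
    [&& partition u.1 D, u.2 \in set0 |: u.1
      & #|u.1| + (u.2 == set0) == k.+1].
  case: u => Q B; rewrite !inE /=.
  case partQ: (partition Q D) => //=.
  case: (eqVneq B set0) => [->|_] /=.
    by rewrite (partition0 partQ) !andbF orbF andbT addn1.
  by rewrite andbF addn0 andbC.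
have -> : partitions (a |: D) k.+1 = insert_point a @: (X0 :|: X1).
  apply/setP=> P; apply/idP/imsetP => [|[[Q B]]].
    rewrite inE => /andP[partP /eqP cardP].
    have [partQ QB PE] := delete_pointP a D P aD partP.
    exists (delete_point a P); last by rewrite PE.
    have [_ cardE _] := insert_pointP a D _ _ aD partQ QB.
    by rewrite X01 partQ QB -cardE -surjective_pairing PE cardP eqxx.
  rewrite X01 => /and3P[/= partQ QB cardQ] ->.
  have [partP cardP _] := insert_pointP a D _ _ aD partQ QB.
  by rewrite inE partP cardP.
rewrite card_in_imset; last first.
  apply: (can_in_inj (g := delete_point a)) => -[Q B].
  rewrite X01 => /and3P[/= partQ QB _].
  by have [] := insert_pointP a D _ _ aD partQ QB.
rewrite cardsU.
have -> : X0 :&: X1 = set0.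
  apply/setP=> -[Q B]; rewrite !inE /=; apply/negP.
  move=> /and3P[/andP[_ /eqP->] /andP[partQ _]].
  by rewrite (partition0 partQ).
rewrite cards0 subn0 cardsX cards1 muln1; congr (_ + _).
rewrite -sum1_card.
rewrite (eq_bigl (fun u => (u.1 \in partitions D k.+1) && (u.2 \in u.1))); last first.
  by move=> u; rewrite inE.
rewrite -(pair_big_dep (fun Q => Q \in partitions D k.+1)
           (fun Q B => B \in Q) (fun _ _ => 1)) /=.
rewrite (eq_bigr (fun _ => k.+1)) ?sum_nat_const 1?mulnC // => Q.
by rewrite inE sum1_card => /andP[_ /eqP].
Qed.

(** Induction on [#|D|] over subsets of a fixed type, so that deleting a point
    from the ground set does not change the type of the blocks. *)
Lemma card_partitions D k : #|partitions D k| = stirling2_rec #|D| k.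
Proof.
have [m] := ubnP #|D|; elim: m D k => // m IHm D k.
have [->|[a aD]] := set_0Vmem D => ltDm.
  rewrite cards0; case: k => [|k] /=.
    apply/eqP/cards1P; exists set0; apply/setP=> P.
    by rewrite !inE partition_set0 cards_eq0 andbb.
  apply/eqP; rewrite cards_eq0; apply/eqP/setP=> P.
  by rewrite !inE partition_set0; case: eqP => // ->; rewrite cards0.
rewrite -[in LHS](setD1K aD) (cardsD1 a D) aD /=.
have {}ltDm : #|D :\ a| < m by move: ltDm; rewrite (cardsD1 a D) aD.
case: k => [|k].
  apply/eqP; rewrite cards_eq0; apply/eqP/setP=> P.
  rewrite !inE cards_eq0; case: eqP => [->|_]; rewrite ?andbF // andbT.
  apply/negP=> /cover_partition/setP/(_ a).
  by rewrite /cover big_set0 !inE eqxx.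
by rewrite card_partitions_setU1 ?setD11 // !IHm.
Qed.

End SetPartitions.

Lemma stirling2E (n k : nat) : stirling2 n k = stirling2_rec n k.
Proof.
rewrite -[n in RHS]card_ord -finset.cardsT -card_partitions.
by rewrite /stirling2.
Qed.


(** * Their generating polynomials *)

Definition stirling2_poly (R : comNzRingType) (n : nat) : {poly R} :=
  \poly_(k < n.+1) (stirling2 n k * k`!)%:R.

Lemma coef_stirling2_poly (R : comNzRingType) n k :
  (stirling2_poly R n)`_k = (stirling2 n k * k`!)%:R.
Proof.
rewrite coef_poly; case: ltnP => // ltnk.
by rewrite stirling2E stirling2_rec_gt.
Qed.

Lemma stirling2_poly0 (R : comNzRingType) : stirling2_poly R 0 = 1.
Proof.
by apply/polyP => k; rewrite coef_stirling2_poly stirling2E coef1; case: k.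
Qed.

(** On the coefficient of X^k, this is the recurrence for S(n+1, k) multiplied
    by k!: the factor k brought out by the derivative is the one in k S(n, k),
    and it turns (k-1)! into k! in the term S(n, k-1) (k-1)! that comes from
    the product with X. *)
Lemma stirling2_polyS (R : comNzRingType) n :
  stirling2_poly R n.+1 = 'X * ((1 + 'X) * stirling2_poly R n)^`().
Proof.
apply/polyP => k; rewrite coef_stirling2_poly coefXM coef_deriv.
rewrite mulrDl mul1r coefD coefXM !coef_stirling2_poly !stirling2E.
case: k => [|k] //=.
rewrite -natrD -mulrnA; congr (_%:R).
by rewrite factS; ring.
Qed.

(** * The derivatives of 1 / (e^t - 1) *)

Section ReciprocalExpm1.
Variable R : realType.

Let u (t : R) : R := 1 / (expR t - 1).

Lemma expRB1_neq0 (t : R) : t != 0 -> expR t - 1 != 0.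
Proof.
by apply: contraNneq => /subr0_eq; rewrite -expR0 => /expR_inj ->.
Qed.

(** The Riccati equation satisfied by u. *)
Lemma is_derive_recip_expRB1 (t : R) : t != 0 ->
  is_derive t 1 u (- (u t * (1 + u t))).
Proof.
move=> t0; have e0 := expRB1_neq0 _ t0.
have dE : is_derive t 1 (fun s : R => expR s - 1) (expR t).
  have dB := is_deriveB (is_derive_expR t) (is_derive_cst (1 : R) t 1).
  by apply: is_derive_eq dB _; rewrite subr0.
have -> : u = fun s => (expR s - 1)^-1 by apply/funext => s; rewrite /u div1r.
apply: is_derive_eq (is_deriveV (f := fun s => expR s - 1) e0 dE) _.
by rewrite /GRing.scale /=; field.
Qed.

Lemma is_derive_horner_recip (p : {poly R}) (t : R) : t != 0 ->
  is_derive t 1 (fun s => p.[u s]) (- ('X * (1 + 'X) * p^`())).[u t].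
Proof.
move=> t0.
have := is_derive1_comp (is_derive_poly p (u t)) (is_derive_recip_expRB1 _ t0).
by move=> d; apply: is_derive_eq d _; rewrite !hornerE; ring.
Qed.

(** The subtracted constant accounts for the difference between u and 1 + u;
    it is present only at order 0. *)
Let w (n : nat) : {poly R} :=
  (-1) ^+ n *: ((1 + 'X) * stirling2_poly R n) - ((n == 0)%:R)%:P.

Lemma w_deriv n : - ('X * (1 + 'X) * (w n)^`()) = w n.+1.
Proof.
rewrite /w derivB derivZ derivC subr0 stirling2_polyS /= subr0 exprS.
by rewrite mulN1r scaleNr -scalerAr mulrCA mulrA.
Qed.

Lemma nbhs_neq0 (t : R) : t != 0 -> \near t, t != 0.
Proof.
by move=> t0; apply: open_nbhs_nbhs; split=> //; exact: open_neq.
Qed.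

(** The induction hypothesis is needed at all points near [t], in order to
    differentiate it at [t]. *)
Lemma derive1n_recip n (t : R) : t != 0 -> u^`(n) t = (w n).[u t].
Proof.
elim: n t => [|n IHn] t t0.
  by rewrite derive1n0 /w stirling2_poly0 scale1r mulr1 !hornerE addrAC subrr add0r.
rewrite derive1nS derive1E -w_deriv.
rewrite (near_eq_derive (g := fun s => (w n).[u s])); last first.
  by near=> s; apply: IHn; near: s; exact: nbhs_neq0.
by have d := is_derive_horner_recip (w n) _ t0; rewrite derive_val.
Unshelve. all: by end_near. Qed.

Lemma derivable_derive1n_recip n (t : R) : t != 0 -> derivable u^`(n) t 1.
Proof.
move=> t0.
have d := is_derive_horner_recip (w n) _ t0.
suff: is_derive t 1 u^`(n) (- ('X * (1 + 'X) * (w n)^`())).[u t] by case.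
apply: near_eq_is_derive d; near=> s; rewrite derive1n_recip //.
by near: s; exact: nbhs_neq0.
Unshelve. all: by end_near. Qed.

End ReciprocalExpm1.

Theorem mainTheorem1 (R : realType) (n : nat) (x : R) :
  (1 <= n)%N -> x != 0 ->
  let f : R -> R := fun t => 1 / (expR t - 1) in
  (forall m : nat, (m < n)%N -> derivable f^`(m) x 1) /\
  f^`(n) x =
    (-1) ^+ n * (expR x / (expR x - 1)) *
    \sum_(1 <= k < n.+1)
       (stirling2 n k)%:R * (k`!)%:R * (1 / (expR x - 1)) ^+ k.
Proof.
move=> n1 x0 f; split=> [m _|]; first exact: derivable_derive1n_recip.
rewrite derive1n_recip //; case: n n1 => // n _.
rewrite subr0 hornerZ hornerM hornerD hornerC hornerX -mulrA.
congr (_ * (_ * _)); first by have ? := expRB1_neq0 _ _ x0; field.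
rewrite horner_poly -(big_mkord xpredT (fun k => (stirling2 n.+1 k * k`!)%:R * _ ^+ k)).
(* The polynomial also has the term k = 0, which vanishes as n > 0. *)
rewrite big_nat_recl // stirling2E mul0r add0r big_add1 /=.
by apply: eq_bigr => k _; rewrite natrM.
Qed.
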